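(* Let $b$ be a locally finite connected graph over $(X,m)$ (with no killing term) satisfying the edge condition: there exists $C>0$ such that $b(x,y)\le C\,m(x)m(y)$ for all $x,y\in X$. Then the Neumann semigroup is Feller.
   Context: Graphs: $X$ is a countable discrete set and $m:X\to(0,\infty)$. A graph $b$ over $(X,m)$ (with killing term $c=0$) is a map $b:X\times X\to[0,\infty)$ with $b(x,y)=b(y,x)$, $b(x,x)=0$, $\sum_{y\in X}b(x,y)<\infty$ for all $x$. It is connected if any two vertices $x,y$ are joined by a path $x=x_0,\dots,x_n=y$ with $b(x_k,x_{k+1})>0$, and locally finite if for every $x$ there are only finitely many $y$ with $b(x,y)>0$. $C_c(X)$ denotes the finitely supported functions; $\ell^2(X,m)$ is the space of $f:X\to\mathbb R$ with $\sum_xf(x)^2m(x)<\infty$. Neumann semigroup: $Q^{(N)}(f)=\frac12\sum_{x,y}b(x,y)(f(x)-f(y))^2$ with domain all $f\in\ell^2(X,m)$ for which this is finite. This is a Dirichlet form; $L^{(N)}$ is the associated nonnegative self-adjoint operator on $\ell^2(X,m)$ and $P^{(N)}_t=e^{-tL^{(N)}}$ the Neumann semigroup. Feller property: $C_0(X)$ is the closure of $C_c(X)$ in the supremum norm. The semigroup $P_t$ is Feller if $P_t(C_c(X))\subseteq C_0(X)$ for some (equivalently, all) $t>0$. *)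

(* Defs.v *)
From HB Require Import structures.
From mathcomp Require Import all_boot all_order all_algebra.
From mathcomp Require Import all_classical all_reals all_analysis.
Set Implicit Arguments.
Unset Strict Implicit.
Unset Printing Implicit Defensive.
Import Order.TTheory GRing.Theory Num.Theory.
Import numFieldNormedType.Exports.
Local Open Scope classical_set_scope.
Local Open Scope ring_scope.

Record is_graph (R : realType) (X : countType) (b : X -> X -> R) : Prop := {
  graph_ge0 : forall x y, 0 <= b x y;
  graph_sym : forall x y, b x y = b y x;
  graph_diag : forall x, b x x = 0;
  graph_summable : forall x, (\esum_(y in [set: X]) (b x y)%:E < +oo)%E
}.

Definition connected_graph (R : realType) (X : countType) (b : X -> X -> R) :
    Prop :=
  forall x y : X, exists p : seq X,
    path (fun u v => 0 < b u v) x p /\ last x p = y.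

Definition locally_finite_graph (R : realType) (X : countType)
    (b : X -> X -> R) : Prop :=
  forall x : X, finite_set [set y | 0 < b x y].

Definition edge_condition (R : realType) (X : countType) (m : X -> R)
    (b : X -> X -> R) : Prop :=
  exists2 C : R, 0 < C & forall x y : X, b x y <= C * (m x * m y).

Definition Cc (R : realType) (X : countType) : set (X -> R) :=
  [set f | finite_set [set x | f x != 0]].

(* [forall x, `|f x - g x| <= e] says that the supremum norm of f - g is at
   most e. *)
Definition C0 (R : realType) (X : countType) : set (X -> R) :=
  [set f | forall e : R, 0 < e ->
     exists2 g, Cc g & forall x, `|f x - g x| <= e].

(* [esum] is meant for nonnegative terms only, hence the splitting.  The value
   is the unconditional sum when f is absolutely summable, which is the case in
   every use below. *)
Definition real_sum (R : realType) (T : choiceType) (f : T -> R) : R :=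
  fine (\esum_(x in [set: T]) (Num.max (f x) 0)%:E) -
  fine (\esum_(x in [set: T]) (Num.max (- f x) 0)%:E).

Definition l2 (R : realType) (X : countType) (m : X -> R) : set (X -> R) :=
  [set f | (\esum_(x in [set: X]) (f x ^+ 2 * m x)%:E < +oo)%E].

Definition l2_dot (R : realType) (X : countType) (m : X -> R) (f g : X -> R) :
    R :=
  real_sum (fun x => f x * g x * m x).

Definition l2_norm (R : realType) (X : countType) (m : X -> R) (f : X -> R) :
    R :=
  Num.sqrt (l2_dot m f f).

Definition energy (R : realType) (X : countType) (b : X -> X -> R)
    (f : X -> R) : \bar R :=
  ((2^-1)%:E *
   \esum_(p in [set: X * X]) (b p.1 p.2 * (f p.1 - f p.2) ^+ 2)%:E)%E.

Definition neumann_domain (R : realType) (X : countType) (m : X -> R)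
    (b : X -> X -> R) : set (X -> R) :=
  [set f | l2 m f /\ (energy b f < +oo)%E].

(* The symmetric bilinear form whose quadratic form is [energy]. *)
Definition neumann_form (R : realType) (X : countType) (b : X -> X -> R)
    (f g : X -> R) : R :=
  2^-1 * real_sum (fun p : X * X =>
                     b p.1 p.2 * (f p.1 - f p.2) * (g p.1 - g p.2)).

(* The graph of the operator associated with the closed form: f belongs to the
   domain of L and L f = g. *)
Definition neumann_laplacian (R : realType) (X : countType) (m : X -> R)
    (b : X -> X -> R) (f g : X -> R) : Prop :=
  [/\ neumann_domain m b f, l2 m g &
      forall h, neumann_domain m b h -> neumann_form b f h = l2_dot m g h].

(* Only the values P t f with 0 <= t and f in l^2(X, m) are constrained. *)
Record is_C0_semigroup (R : realType) (X : countType) (m : X -> R)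
    (P : R -> (X -> R) -> (X -> R)) : Prop := {
  semigroup_l2 : forall t f, 0 <= t -> l2 m f -> l2 m (P t f);
  semigroup_linear : forall t (a : R) f g, 0 <= t -> l2 m f -> l2 m g ->
    P t (fun x => a * f x + g x) = (fun x => a * P t f x + P t g x);
  semigroup_bounded : forall t, 0 <= t -> exists M : R,
    forall f, l2 m f -> l2_norm m (P t f) <= M * l2_norm m f;
  semigroup0 : forall f, l2 m f -> P 0 f = f;
  semigroupD : forall s t f, 0 <= s -> 0 <= t -> l2 m f ->
    P (s + t) f = P s (P t f);
  semigroup_cvg : forall f, l2 m f ->
    l2_norm m (fun x => P t f x - f x) @[t --> 0^'+] --> (0 : R)
}.

(* P_t = e^{-tL}: the operator -L, given by its graph, is the infinitesimal
   generator of P, i.e. f is in the domain of L with L f = g if and only if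
   (f - P_t f) / t tends to g in l^2(X, m) as t decreases to 0.  A strongly
   continuous semigroup is determined by its generator. *)
Definition is_exp_semigroup (R : realType) (X : countType) (m : X -> R)
    (L : (X -> R) -> (X -> R) -> Prop) (P : R -> (X -> R) -> (X -> R)) : Prop :=
  is_C0_semigroup m P /\
  forall f g, l2 m f -> l2 m g ->
    (L f g <->
     l2_norm m (fun x => (f x - P t f x) / t - g x) @[t --> 0^'+] --> (0 : R)).

Definition is_neumann_semigroup (R : realType) (X : countType) (m : X -> R)
    (b : X -> X -> R) (P : R -> (X -> R) -> (X -> R)) : Prop :=
  is_exp_semigroup m (neumann_laplacian m b) P.

Definition feller (R : realType) (X : countType)
    (P : R -> (X -> R) -> (X -> R)) : Prop :=
  forall t : R, 0 < t -> forall f, Cc f -> C0 (P t f).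

(* Main.v *)
Require Import Defs.
From mathcomp Require Import all_boot all_order all_algebra.
From mathcomp Require Import all_classical all_reals all_analysis.
From mathcomp Require Import ring lra.
Set Implicit Arguments.
Unset Strict Implicit.
Unset Printing Implicit Defensive.
Import Order.TTheory GRing.Theory Num.Theory.
Import numFieldNormedType.Exports.
Local Open Scope ring_scope.

(** Why the semigroup is Feller.  Let u_s = P_s f with f finitely supported and
    let s range over [0, T].  Local finiteness puts f in the domain of the
    generator, and testing the weak equation for u_s against the indicator of a
    vertex x shows that s |-> u_s(x) solves, at every vertex,
      m(x) d/ds u_s(x) = - sum_y b(x, y) (u_s(x) - u_s(y)).
    Multiply by 2 u_s(x) / m(x), complete the square and use the edge condition
    b(x, y) / m(x) <= C m(y):
      d/ds u_s(x)^2 <= (C / 2) sum_(y ~ x) m(y) u_s(y)^2.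
    The right-hand side is a part of the squared l^2 norm of u_s: however small
    m(x) is, u_s(x) is controlled by the l^2 mass that u_s carries on the
    neighbours of x.  The curve s |-> u_s is continuous, so its image over
    [0, T] is compact in l^2 and for every q there is a finite set K outside of
    which every u_s has l^2 mass at most q.  All vertices but finitely many lie
    outside the support of f and have no neighbour in K, by local finiteness;
    at such an x the inequality integrates to u_T(x)^2 <= T C q / 2.

    The graph part is [Cc_laplacian] and [laplacian_pointwise] (Green's formula
    for a finitely supported function), [dissipation_le] (the differential
    inequality) and the theorem itself.

    Strong continuity of P is given at 0 only, from the right.  Both the compact
    orbit and the differential inequality need bounds on P_s that are uniform
    over [0, T]; these come from the uniform boundedness principle in l^2
    ([l2_uniform_boundedness], [semigroup_bounded_on]).  With them the forward
    difference quotients of s |-> u_s converge uniformly in s, and the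
    differential inequality is integrated by adding up forward differences
    ([forward_difference_le]). *)

(** * Sums over a discrete set and their finite partial sums *)

Section FiniteSums.
Context {R : realType} {T : choiceType}.
Implicit Types (a f : T -> R) (s : seq T).

Lemma sum_le_esum a s : uniq s ->
  ((\sum_(x <- s) a x)%:E <= \esum_(x in [set: T]) (a x)%:E)%E.
Proof.
move=> us; apply: esum_ge; exists [set` s]%classic.
  by split; [exact: finite_seq|].
by rewrite -fsbig_seq// sumEFin.
Qed.

Lemma esum_le_sum a (B : \bar R) :
    (forall s, uniq s -> ((\sum_(x <- s) a x)%:E <= B)%E) ->
  (\esum_(x in [set: T]) (a x)%:E <= B)%E.
Proof.
move=> aB; apply: ge_ereal_sup => _ [F [finF _] <-].
by rewrite fsbig_finite// sumEFin; apply: aB.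
Qed.

Lemma esum_seq a s : uniq s -> (forall x, 0 <= a x) ->
    (forall x, x \notin s -> a x = 0) ->
  (\esum_(x in [set: T]) (a x)%:E = (\sum_(x <- s) a x)%:E)%E.
Proof.
move=> us a0 as0.
rewrite (@eq_esum _ _ _ _ 
  (fun x => if x \in [set` s]%classic then (a x)%:E else 0%E)).
  rewrite -esum_mkcond esum_fset//; last by move=> i _; rewrite lee_fin.
  by rewrite -fsbig_seq// sumEFin.
move=> x _; case: ifPn => //; rewrite notin_setE /= => /negP xs.
by rewrite as0.
Qed.

Lemma real_sum_seq f s : uniq s -> (forall x, x \notin s -> f x = 0) ->
  real_sum f = \sum_(x <- s) f x.
Proof.
move=> us fs; rewrite /real_sum.
rewrite (@esum_seq (fun x => Num.max (f x) 0) s)//; first last.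
- by move=> x /fs ->; rewrite maxxx.
- by move=> x; rewrite le_max lexx orbT.
rewrite (@esum_seq (fun x => Num.max (- f x) 0) s)//; first last.
- by move=> x /fs ->; rewrite oppr0 maxxx.
- by move=> x; rewrite le_max lexx orbT.
rewrite /= -sumrB; apply: eq_bigr => x _.
by rewrite /Order.max; case: ltP => ?; case: ltP => ?; lra.
Qed.

End FiniteSums.

(** * The space l^2(X, m) *)

Section WeightedL2.
Context {R : realType} {X : countType} (m : X -> R).
Hypothesis m_gt0 : forall x, 0 < m x.
Implicit Types (f g h : X -> R) (s : seq X) (a B : R).

Definition sqnorm f : R := l2_dot m f f.

Lemma sqnormE f :
  sqnorm f = fine (\esum_(x in [set: X]) (f x ^+ 2 * m x)%:E).
Proof.
rewrite /sqnorm /l2_dot /real_sum.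
have pos x : 0 <= f x * f x * m x.
  by rewrite mulr_ge0 ?(ltW (m_gt0 x))// -expr2 sqr_ge0.
have E : forall x : X, [set: X]%classic x ->
   (Num.max (f x * f x * m x) 0)%:E = (f x ^+ 2 * m x)%:E.
  by move=> x _; rewrite expr2 (max_idPl (pos x)).
rewrite (eq_esum E).
rewrite (esum1 (a := fun x => (Num.max (- (f x * f x * m x)) 0)%:E)).
  by rewrite /= subr0.
by move=> x _; congr EFin; apply/max_idPr; rewrite oppr_le0.
Qed.

Lemma l2_norm_sqrt f : l2_norm m f = Num.sqrt (sqnorm f). Proof. by []. Qed.

Lemma sqterm_ge0 f x : 0 <= f x ^+ 2 * m x.
Proof. by rewrite mulr_ge0 ?sqr_ge0// ltW. Qed.

Lemma sqnorm_ge0 f : 0 <= sqnorm f.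
Proof.
rewrite sqnormE; apply: fine_ge0; apply: esum_ge0 => x _.
by rewrite lee_fin sqterm_ge0.
Qed.

Lemma sqr_l2_norm f : l2_norm m f ^+ 2 = sqnorm f.
Proof. by rewrite l2_norm_sqrt sqr_sqrtr ?sqnorm_ge0. Qed.

Lemma l2_fin_num f : l2 m f ->
  (\esum_(x in [set: X]) (f x ^+ 2 * m x)%:E = (sqnorm f)%:E)%E.
Proof.
move=> lf; rewrite sqnormE fineK// ge0_fin_numE//.
by apply: esum_ge0 => x _; rewrite lee_fin sqterm_ge0.
Qed.

Lemma sum_le_sqnorm f s : l2 m f -> uniq s ->
  \sum_(x <- s) f x ^+ 2 * m x <= sqnorm f.
Proof.
move=> lf us; rewrite -lee_fin -l2_fin_num//.
exact: (@sum_le_esum _ _ (fun x => f x ^+ 2 * m x)).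
Qed.

Lemma term_le_sqnorm f x : l2 m f -> f x ^+ 2 * m x <= sqnorm f.
Proof.
move=> lf; have := @sum_le_sqnorm f [:: x] lf isT.
by rewrite big_seq1.
Qed.

(** Membership in l^2 and bounds on the norm are always obtained from finite
    sums, where the algebra of real numbers applies. *)
Lemma l2_bounded_sums f B :
    (forall s, uniq s -> \sum_(x <- s) f x ^+ 2 * m x <= B) ->
  l2 m f /\ sqnorm f <= B.
Proof.
move=> fB.
have le : (\esum_(x in [set: X]) (f x ^+ 2 * m x)%:E <= B%:E)%E.
  apply: (@esum_le_sum _ _ (fun x => f x ^+ 2 * m x)) => s us.
  by rewrite lee_fin fB.
have lf : l2 m f by rewrite /l2 /=; apply: le_lt_trans le _; rewrite ltry.
by split=> //; rewrite -lee_fin -l2_fin_num.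
Qed.

Lemma sqnorm_approx f e : l2 m f -> 0 < e ->
  exists2 s, uniq s & sqnorm f - e < \sum_(x <- s) f x ^+ 2 * m x.
Proof.
move=> lf e0; apply: contrapT => H.
have [|_] := @l2_bounded_sums f (sqnorm f - e); last by lra.
move=> s us; rewrite leNgt; apply/negP => lt; apply: H.
by exists s.
Qed.

Lemma l2_bound_comb f g h a B : l2 m g -> l2 m h -> 0 <= a -> 0 <= B ->
    (forall x, f x ^+ 2 <= a * g x ^+ 2 + B * h x ^+ 2) ->
  l2 m f /\ sqnorm f <= a * sqnorm g + B * sqnorm h.
Proof.
move=> lg lh a0 B0 le; apply: l2_bounded_sums => s us.
apply: le_trans (_ : a * (\sum_(x <- s) g x ^+ 2 * m x) +
   B * (\sum_(x <- s) h x ^+ 2 * m x) <= _); last first.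
  by apply: lerD; apply: ler_wpM2l => //; apply: sum_le_sqnorm.
rewrite !mulr_sumr -big_split /=; apply: ler_sum => x _.
rewrite (mulrA a) (mulrA B) -mulrDl; apply: ler_wpM2r; first exact: ltW.
exact: le.
Qed.

Lemma l2D f g : l2 m f -> l2 m g -> l2 m (fun x => f x + g x).
Proof.
move=> lf lg; apply: proj1 (@l2_bound_comb _ f g 2 2 lf lg _ _ _) => //.
by move=> x; have := sqr_ge0 (f x - g x); lra.
Qed.

(** This consequence of the parallelogram law does the work of the triangle
    inequality: all estimates tolerate a constant factor, and squared norms
    are sums, without square roots. *)
Lemma sqnormD_le f g : l2 m f -> l2 m g ->
  sqnorm (fun x => f x + g x) <= 2 * sqnorm f + 2 * sqnorm g.
Proof.
move=> lf lg; apply: proj2 (@l2_bound_comb _ f g 2 2 lf lg _ _ _) => //.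
by move=> x; have := sqr_ge0 (f x - g x); lra.
Qed.

Lemma l2B f g : l2 m f -> l2 m g -> l2 m (fun x => f x - g x).
Proof.
move=> lf lg; apply: proj1 (@l2_bound_comb _ f g 2 2 lf lg _ _ _) => //.
by move=> x; have := sqr_ge0 (f x + g x); lra.
Qed.

Lemma sqnormB_le f g : l2 m f -> l2 m g ->
  sqnorm (fun x => f x - g x) <= 2 * sqnorm f + 2 * sqnorm g.
Proof.
move=> lf lg; apply: proj2 (@l2_bound_comb _ f g 2 2 lf lg _ _ _) => //.
by move=> x; have := sqr_ge0 (f x + g x); lra.
Qed.

Lemma sqnorm_le_dist f g : l2 m f -> l2 m g ->
  sqnorm f <= 2 * sqnorm (fun x => f x - g x) + 2 * sqnorm g.
Proof.
move=> lf lg; have := sqnormD_le (l2B lf lg) lg.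
by under [in X in X -> _]eq_fun do rewrite subrK.
Qed.

Lemma l2Z a f : l2 m f -> l2 m (fun x => a * f x).
Proof.
move=> lf; apply: proj1 (@l2_bound_comb _ f f (a ^+ 2) 0 lf lf _ _ _) => //.
  by rewrite sqr_ge0.
by move=> x; rewrite mul0r addr0 exprMn.
Qed.

Lemma sqnormZ_le a f : l2 m f -> sqnorm (fun x => a * f x) <= a ^+ 2 * sqnorm f.
Proof.
move=> lf.
have := proj2 (@l2_bound_comb (fun x => a * f x) f f (a ^+ 2) 0 lf lf _ _ _).
rewrite mul0r addr0; apply=> //; first by rewrite sqr_ge0.
by move=> x; rewrite mul0r addr0 exprMn.
Qed.

Lemma sqnormZ a f : l2 m f -> sqnorm (fun x => a * f x) = a ^+ 2 * sqnorm f.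
Proof.
move=> lf; apply/eqP; rewrite eq_le sqnormZ_le//=.
have [->|a0] := eqVneq a 0; first by rewrite expr0n mul0r sqnorm_ge0.
have := sqnormZ_le a^-1 (l2Z a lf).
under [in X in X -> _]eq_fun do rewrite mulKf//.
rewrite exprVn => le; rewrite -ler_pdivlMl//.
by rewrite exprn_even_gt0.
Qed.

Lemma l2_Cc f : Cc f -> l2 m f.
Proof.
move=> /finite_seqP[s fs].
have [|//] := @l2_bounded_sums f (\sum_(x <- undup s) f x ^+ 2 * m x).
suff E : (\esum_(x in [set: X]) (f x ^+ 2 * m x)%:E =
          (\sum_(x <- undup s) f x ^+ 2 * m x)%:E)%E.
  move=> t ut; rewrite -lee_fin -E.
  exact: (@sum_le_esum _ _ (fun x => f x ^+ 2 * m x)).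
apply: (@esum_seq _ _ (fun x => f x ^+ 2 * m x)); first exact: undup_uniq.
  by move=> x; exact: sqterm_ge0.
move=> x; rewrite mem_undup => xs.
suff -> : f x = 0 by rewrite expr0n mul0r.
apply/eqP; apply: contraNT xs => fx0.
by have : [set` s]%classic x by rewrite -fs.
Qed.

Lemma l2_tail f e : l2 m f -> 0 < e ->
  exists s, forall t, uniq t -> (forall x, x \in t -> x \notin s) ->
    \sum_(x <- t) f x ^+ 2 * m x <= e.
Proof.
move=> lf e0; have [s us lts] := sqnorm_approx lf e0.
exists s => t ut ts.
have ust : uniq (s ++ t).
  by rewrite cat_uniq us ut andbT; apply/hasPn => x /ts.
have := @sum_le_sqnorm f (s ++ t) lf ust; rewrite big_cat /=.
by move: lts; lra.
Qed.

(** Completeness of l^2: the limit exists at each point because m x > 0, and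
    the rate r passes to the limit in every finite sum. *)
Lemma l2_complete (u : nat -> X -> R) (r : nat -> R) :
    (forall n, l2 m (u n)) ->
    (forall e, 0 < e -> exists n, r n < e) ->
    (forall n j, sqnorm (fun x => u (n + j)%N x - u n x) <= r n) ->
  exists2 f, l2 m f & forall n, sqnorm (fun x => f x - u n x) <= r n.
Proof.
move=> lu r0 ur.
have cv x : cvgn (fun n => u n x).
  apply/cauchy_cvgP/cauchy_exP => e e0.
  have [n rn] := r0 (e ^+ 2 * m x) (mulr_gt0 (exprn_gt0 _ e0) (m_gt0 x)).
  exists (u n x); exists n => //= k /= nk.
  rewrite -ball_normE /ball_ /= -(subnKC nk).
  have lku := l2B (lu (n + (k - n))%N) (lu n).
  have := le_trans (term_le_sqnorm x lku) (ur n (k - n)%N).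
  move=> /le_lt_trans /(_ rn); rewrite ltr_pM2r// distrC.
  rewrite -[X in X < _]real_normK ?num_real//.
  by rewrite ltr_sqr ?nnegrE// ltW.
pose f x : R := limn (fun n => u n x).
have H n : l2 m (fun x => f x - u n x) /\ sqnorm (fun x => f x - u n x) <= r n.
  apply: l2_bounded_sums => s us.
  have cvs : (\sum_(x <- s) (u k x - u n x) ^+ 2 * m x @[k --> \oo]
             --> \sum_(x <- s) (f x - u n x) ^+ 2 * m x)%classic.
    apply: cvg_big; [exact: add_continuous|move=> x _].
    apply: cvgM; last exact: cvg_cst.
    rewrite expr2; under eq_cvg do rewrite expr2.
    by apply: cvgM; apply: cvgB; [exact: cv|exact: cvg_cst|exact: cv|
      exact: cvg_cst].
  rewrite -(cvg_lim _ cvs)//; apply: limr_le.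
    by apply/cvg_ex; eexists; exact: cvs.
  exists n => //= k /= nk; apply: le_trans (ur n (k - n)%N); rewrite subnKC//.
  by apply: sum_le_sqnorm => //; apply: l2B.
exists f => [|n]; last exact: (H n).2.
have := l2D (H 0).1 (lu 0).
by under eq_fun do rewrite subrK.
Qed.

End WeightedL2.

(** * Uniform boundedness principle in l^2 *)

Section UniformBoundedness.
Context {R : realType} {X : countType} (m : X -> R).
Hypothesis m_gt0 : forall x, 0 < m x.
Implicit Types (f g h : X -> R).
Local Notation sq := (sqnorm m).

Definition l2_operator (T : (X -> R) -> X -> R) : Prop :=
  [/\ forall f, l2 m f -> l2 m (T f),
      forall (a : R) f g, l2 m f -> l2 m g ->
        T (fun x => a * f x + g x) = (fun x => a * T f x + T g x) &
      exists B : R, forall f, l2 m f -> sq (T f) <= B * sq f].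

Section OneOperator.
Variable T : (X -> R) -> X -> R.
Hypothesis T_op : l2_operator T.

Lemma l2_operator0 : T (fun=> 0) = (fun=> 0).
Proof.
case: T_op => _ lin _.
have l0 : l2 m (fun=> 0).
  apply: (l2_Cc m_gt0); rewrite /Cc /= (_ : [set _ | _]%classic = set0)//.
  by apply/seteqP; split=> x //=; rewrite eqxx.
have := lin (-1) _ _ l0 l0.
under [in X in X -> _]eq_fun do rewrite mulr0 addr0.
move=> ->; apply/funext => x; by rewrite mulN1r addNr.
Qed.

Lemma l2_operatorZ a f : l2 m f -> T (fun x => a * f x) = (fun x => a * T f x).
Proof.
case: T_op => _ lin _ lf.
have l0 : l2 m (fun=> 0 * 0).
  by have := l2Z m_gt0 0 lf; under eq_fun do rewrite mul0r -(mul0r 0).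
have := lin a _ _ lf l0; under [in X in X -> _]eq_fun do rewrite mulr0 addr0.
move=> ->; apply/funext => x.
under [in X in _ + X]eq_fun do rewrite mulr0.
by rewrite l2_operator0 addr0.
Qed.

Lemma l2_operatorB f g : l2 m f -> l2 m g ->
  T (fun x => f x - g x) = (fun x => T f x - T g x).
Proof.
case: T_op => _ lin _ lf lg; have := lin (-1) _ _ lg lf.
under [in X in X -> _]eq_fun do rewrite mulN1r addrC.
by move=> ->; apply/funext => x; rewrite mulN1r addrC.
Qed.

(** S is the supremum of sq (T f) over the unit ball, that is, the square of the
    operator norm of T. *)
Lemma almost_maximizer (A : R) g : l2 m g -> 0 <= A -> A * sq g < sq (T g) ->
  exists S h, [/\ A < S, l2 m h, sq h <= 1, S / 2 <= sq (T h) &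
                  forall f, l2 m f -> sq (T f) <= S * sq f].
Proof.
case: (T_op) => Tl2 _ [B TB] lg A0 Ag.
pose E : set R :=
  [set y | exists f, [/\ l2 m f, sq f <= 1 & y = sq (T f)]]%classic.
have E_ub : has_ubound E.
  exists `|B| => y [f [lf f1 ->]]; apply: le_trans (TB f lf) _.
  apply: le_trans (_ : `|B| * sq f <= _).
    by apply: ler_wpM2r; rewrite ?ler_norm ?sqnorm_ge0.
  by rewrite -[leRHS]mulr1; apply: ler_wpM2l.
have bound f : l2 m f -> sq (T f) <= sup E * sq f.
  move=> lf; have [f0|f0] := eqVneq (sq f) 0.
    by have := TB f lf; rewrite f0 !mulr0.
  have fp : 0 < sq f by rewrite lt_neqAle eq_sym f0 sqnorm_ge0.
  pose a := (Num.sqrt (sq f))^-1.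
  have a2 : a ^+ 2 = (sq f)^-1 by rewrite exprVn sqr_sqrtr ?sqnorm_ge0.
  have le : sq (T (fun x => a * f x)) <= sup E.
    apply: ub_le_sup => //; exists (fun x => a * f x); split=> //.
      exact: l2Z.
    by rewrite sqnormZ// a2 mulVf.
  move: le; rewrite l2_operatorZ// sqnormZ ?a2 ?ler_pdivrMl//; last exact: Tl2.
  by rewrite mulrC.
have AS : A < sup E.
  have := lt_le_trans Ag (bound g lg); move: (sqnorm_ge0 m_gt0 g).
  rewrite le_eqVlt => /orP[/eqP <-|gp]; first by rewrite !mulr0 ltxx.
  by rewrite ltr_pM2r.
have S2 : 0 < sup E / 2 by rewrite divr_gt0//; lra.
have E_sup : has_sup E.
  split=> //; exists (sq (T (fun x => 0 * g x))), (fun x => 0 * g x).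
  split=> //.
    exact: l2Z.
  by rewrite sqnormZ// expr0n mul0r.
have [_ [h [lh h1 ->]] hS] := sup_adherent S2 E_sup.
exists (sup E), h; split=> //; lra.
Qed.

(** Since c h is half the difference of v + c h and v - c h, one of these two
    points has an image at least as long as that of c h, whatever v is. *)
Lemma push_away (c S : R) v h : l2 m v -> l2 m h ->
    sq h <= 1 -> S / 2 <= sq (T h) ->
  exists w, [/\ l2 m w, sq (fun x => w x - v x) <= c ^+ 2 &
                c ^+ 2 * S / 2 <= sq (T w)].
Proof.
case: (T_op) => Tl2 _ _ lv lh h1 hS.
have lch := l2Z m_gt0 c lh.
pose p x := v x + c * h x; pose q x := v x - c * h x.
have lp : l2 m p by apply: l2D.
have lq : l2 m q by apply: l2B.
have sch : sq (fun x => c * h x) <= c ^+ 2.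
  rewrite sqnormZ// -[leRHS]mulr1; apply: ler_wpM2l => //; exact: sqr_ge0.
have E : (fun x => c * T h x) = (fun x => 2^-1 * (T p x - T q x)).
  have lpq : l2 m (fun x => p x - q x) by apply: l2B.
  have -> : (fun x => 2^-1 * (T p x - T q x)) =
            (fun x => 2^-1 * T (fun x => p x - q x) x) by rewrite l2_operatorB.
  rewrite -l2_operatorZ//.
  rewrite -(l2_operatorZ 2^-1 lpq); congr T.
  by apply/funext => x; rewrite /p /q; field.
have le1 : c ^+ 2 * S / 2 <= c ^+ 2 * sq (T h).
  by rewrite -mulrA; apply: ler_wpM2l => //; exact: sqr_ge0.
have le2 : c ^+ 2 * sq (T h) <= 2^-1 * (sq (T p) + sq (T q)).
  have lT : l2 m (fun x => T p x - T q x) by apply: l2B => //; exact: Tl2.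
  have <- : sq (fun x => c * T h x) = c ^+ 2 * sq (T h).
    by rewrite sqnormZ//; exact: Tl2.
  rewrite E sqnormZ//.
  have := sqnormB_le m_gt0 (Tl2 _ lp) (Tl2 _ lq); lra.
have [qp|/ltW pq] := leP (sq (T q)) (sq (T p)).
  exists p; split=> //; last by lra.
  by under eq_fun do rewrite /p addrAC subrr add0r.
exists q; split=> //; last by lra.
have -> : (fun x => q x - v x) = (fun x => (-1) * (c * h x)).
  by apply/funext => x; rewrite /q; ring.
by rewrite sqnormZ// sqrrN expr1n mul1r.
Qed.

End OneOperator.

(** Banach-Steinhaus by a gliding hump.  Were the norms unbounded, step k of a
    walk in l^2 could use an operator of squared norm S > 16 k 64^k: it moves by
    8^-k along a near-maximizer of that operator, in the direction that makes
    the image of the new position long, of squared length at least S 64^-k / 2.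
    The steps shrink so fast that the walk converges and that the remaining
    ones, of total squared length at most 64^-k / 16, cannot bring the image
    back; so the images of the limit under these operators are unbounded. *)
Lemma l2_uniform_boundedness (T : nat -> (X -> R) -> X -> R) :
    (forall n, l2_operator (T n)) ->
    (forall f, l2 m f -> exists B N, forall n, (N <= n)%N -> sq (T n f) <= B) ->
  exists M N, forall n, (N <= n)%N -> forall f, l2 m f ->
    sq (T n f) <= M * sq f.
Proof.
move=> T_op T_pt; apply: contrapT => unbounded.
have step1 k : exists p : nat * R * (X -> R), (k <= p.1.1)%N /\
    [/\ 16 * k%:R * 64 ^+ k < p.1.2, l2 m p.2, sq p.2 <= 1,
      p.1.2 / 2 <= sq (T p.1.1 p.2) &
    forall f, l2 m f -> sq (T p.1.1 f) <= p.1.2 * sq f].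
  pose A : R := 16 * k%:R * 64 ^+ k.
  have A0 : 0 <= A by rewrite /A !mulr_ge0// exprn_ge0.
  apply: contrapT => H; apply: unbounded; exists A, k => n kn f lf.
  rewrite leNgt; apply/negP => lt; apply: H.
  have [S [h [AS lh h1 hS bd]]] := almost_maximizer (T_op n) lf A0 lt.
  by exists (n, S, h).
have [p pP] := choice step1.
pose c k : R := 8 ^- k.
have c2 k : c k ^+ 2 = 64 ^- k.
  by rewrite /c exprVn -exprM mulnC exprM; congr (_ ^+ _)^-1; ring.
have step2 (kv : nat * (X -> R)) : exists w, l2 m kv.2 ->
   [/\ l2 m w, sq (fun x => w x - kv.2 x) <= c kv.1 ^+ 2 &
       c kv.1 ^+ 2 * (p kv.1).1.2 / 2 <= sq (T (p kv.1).1.1 w)].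
  case: kv => k v /=; have [_ [_ lh h1 hS _]] := pP k.
  have [lv|nlv] := pselect (l2 m v); last by exists v => /nlv.
  have [w wP] := push_away (T_op (p k).1.1) (c k) lv lh h1 hS.
  by exists w.
have [st stP] := choice step2.
pose u k := iteri k (fun i v => st (i, v)) (fun=> 0).
have lu k : l2 m (u k).
  elim: k => [|k IH]; last by have [] := stP (k, u k) IH.
  have [_ [_ lh _ _ _]] := pP 0; have := l2Z m_gt0 0 lh.
  by under eq_fun do rewrite mul0r.
have du k : sq (fun x => u k.+1 x - u k x) <= 64 ^- k.
  by rewrite -c2; have [] := stP (k, u k) (lu k).
have Tu k : 64 ^- k * (p k).1.2 / 2 <= sq (T (p k).1.1 (u k.+1)).
  by rewrite -c2; have [] := stP (k, u k) (lu k).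
have dist n j : sq (fun x => u (n + j)%N x - u n x) <= 4 * 64 ^- n.
  elim: j n => [|j IH] n.
    rewrite addn0.
    have -> : (fun x => u n x - u n x) = (fun x => 0 * u n x).
      by apply/funext => x; rewrite subrr mul0r.
    rewrite sqnormZ// expr0n mul0r mulr_ge0// invr_ge0 exprn_ge0//.
  have := sqnormD_le m_gt0 (l2B m_gt0 (lu (n.+1 + j)%N) (lu n.+1))
    (l2B m_gt0 (lu n.+1) (lu n)).
  under [in X in X -> _]eq_fun do rewrite subrKA.
  rewrite addSnnS => /le_trans; apply.
  have := IH n.+1; rewrite addSnnS; have := du n.
  rewrite exprS invfM; have : 0 <= 64 ^- n :> R by rewrite invr_ge0 exprn_ge0.
  lra.
have small (e : R) : 0 < e -> exists n, 4 * 64 ^- n < e.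
  move=> e0; exists (Num.truncn (4 / e)).+1; set n := (Num.truncn _).+1.
  have gt : 4 / e < n%:R by exact: truncnS_gt.
  rewrite ltr_pdivrMr ?exprn_gt0// mulrC -ltr_pdivrMr//.
  apply: lt_le_trans gt _; rewrite -natrX ler_nat.
  by apply: ltnW; apply: ltn_expl.
have [f lf fu] := l2_complete m_gt0 lu small dist.
have grow k : k%:R <= sq (T (p k).1.1 f).
  have [_ [SA _ _ _ bd]] := pP k; have [Tl2 _ _] := T_op (p k).1.1.
  have := fu k.+1; rewrite exprS invfM => fuk.
  have := sqnorm_le_dist m_gt0 (Tl2 _ (lu k.+1)) (Tl2 _ lf).
  rewrite -(l2_operatorB (T_op _))//.
  have := bd _ (l2B m_gt0 (lu k.+1) lf).
  have -> : sq (fun x => u k.+1 x - f x) = sq (fun x => f x - u k.+1 x).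
    rewrite -[RHS]mul1r -[X in X * _](expr1n _ 2) -sqrrN -(sqnormZ m_gt0);
      last exact: l2B.
    by congr sqnorm; apply/funext => x; ring.
  have := Tu k; move: fuk SA.
  set d := sq (fun x => f x - _); set S := (p k).1.2; set w := _ ^- k.
  move=> dw SA h1 h2 h3.
  have w0 : 0 < w by rewrite invr_gt0 exprn_gt0.
  have S0 : 0 < S by apply: le_lt_trans SA; rewrite !mulr_ge0// exprn_ge0.
  have wS : 16 * k%:R < w * S.
    have w64 : w * 64 ^+ k = 1 by rewrite mulVf// gt_eqF// exprn_gt0.
    by move: SA; rewrite -(ltr_pM2l w0) mulrCA w64 mulr1.
  have Sd : S * d <= S * (4 * (64^-1 * w)).
    by apply: ler_wpM2l => //; exact: ltW.
  have k0 : 0 <= k%:R :> R by [].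
  nra.
have [B [N BN]] := T_pt f lf.
pose k := maxn N (Num.truncn B).+1.
have [kn _] := pP k.
have Nn : (N <= (p k).1.1)%N by apply: leq_trans kn; rewrite leq_maxl.
have := le_trans (grow k) (BN _ Nn).
apply/negP; rewrite -ltNge; apply: lt_le_trans (truncnS_gt B) _.
by rewrite ler_nat leq_maxr.
Qed.

End UniformBoundedness.

(** * Green's formula and the energy dissipated at a vertex *)

Section Graph.
Context {R : realType} {X : countType} (m : X -> R) (b : X -> X -> R).
Hypothesis m_gt0 : forall x, 0 < m x.
Hypothesis b_graph : is_graph b.
Hypothesis b_locally_finite : locally_finite_graph b.
Implicit Types (f g h k : X -> R) (s F : seq X).

Let b_ge0 x y : 0 <= b x y := graph_ge0 b_graph x y.
Let b_sym x y : b x y = b y x := graph_sym b_graph x y.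

Lemma neighbours_exist :
  exists N : X -> seq X,
    forall x, uniq (N x) /\ forall y, (y \in N x) = (0 < b x y).
Proof.
suff H x : exists s, uniq s /\ forall y, (y \in s) = (0 < b x y).
  by have [N NP] := choice H; exists N.
have /finite_seqP[s sE] := b_locally_finite x.
exists (undup s); split=> [|y]; first exact: undup_uniq.
rewrite mem_undup; apply/idP/idP => ys.
  by have : [set` s]%classic y by []; rewrite -sE.
by have : [set y | 0 < b x y]%classic y by []; rewrite sE.
Qed.

(** On a finite set that contains the support of f and all neighbours of the
    support, all sums in the form of f reduce to finite ones. *)
Lemma Cc_hull f : Cc f -> exists F, [/\ uniq F,
  forall x, x \notin F -> f x = 0 &
  forall x y, f x != 0 -> b x y != 0 -> y \in F].
Proof.
move=> /finite_seqP[s sE]; have [N NP] := neighbours_exist.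
have fs x : f x != 0 -> x \in s.
  by move=> fx; have : [set x | f x != 0]%classic x by []; rewrite sE.
exists (undup (s ++ flatten (map N s))); split.
- exact: undup_uniq.
- move=> x; rewrite mem_undup mem_cat negb_or => /andP[xs _].
  by apply/eqP; apply: contraNT xs => /fs.
- move=> x y /fs xs bxy; rewrite mem_undup mem_cat; apply/orP; right.
  apply/flatten_mapP; exists x => //.
  by rewrite (NP x).2 lt_neqAle eq_sym bxy b_ge0.
Qed.

Section Hull.
Variables (k : X -> R) (F : seq X).
Hypotheses (F_uniq : uniq F) (kF : forall x, x \notin F -> k x = 0).
Hypothesis F_nbr : forall x y, k x != 0 -> b x y != 0 -> y \in F.

Lemma edge_term0 p : p \notin [seq (x, y) | x <- F, y <- F] ->
  b p.1 p.2 * (k p.1 - k p.2) = 0.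
Proof.
case: p => x y /= pF; have [->|bxy] := eqVneq (b x y) 0; first by rewrite mul0r.
have [kx|kx] := eqVneq (k x) 0; have [ky|ky] := eqVneq (k y) 0.
- by rewrite kx ky subrr mulr0.
- exfalso; move/negP: pF; apply; apply/allpairs_f.
    by apply: (F_nbr ky); rewrite b_sym.
  by apply: contraNT ky => /kF ->.
- exfalso; move/negP: pF; apply; apply/allpairs_f; last exact: (F_nbr kx).
  by apply: contraNT kx => /kF ->.
- exfalso; move/negP: pF; apply; apply/allpairs_f; last exact: (F_nbr kx).
  by apply: contraNT kx => /kF ->.
Qed.

Lemma pairs_uniq : uniq [seq (x, y) | x <- F, y <- F].
Proof. by apply: allpairs_uniq => // -[x y] [x' y']. Qed.

Lemma energy_finite : (energy b k < +oo)%E.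
Proof.
rewrite /energy (@esum_seq _ _
  (fun p : X * X => b p.1 p.2 * (k p.1 - k p.2) ^+ 2)
  [seq (x, y) | x <- F, y <- F]).
- by rewrite -EFinM ltry.
- exact: pairs_uniq.
- by move=> p; rewrite mulr_ge0// sqr_ge0.
- by move=> p /edge_term0; rewrite expr2 mulrA => ->; rewrite mul0r.
Qed.

Lemma form_hull h : neumann_form b k h =
  2^-1 * \sum_(x <- F) \sum_(y <- F) b x y * (k x - k y) * (h x - h y).
Proof.
rewrite /neumann_form (real_sum_seq pairs_uniq).
  by rewrite big_allpairs.
by move=> p /edge_term0 ->; rewrite mul0r.
Qed.

(** The differences can be collected on the finitely supported function k, which
    exhibits its Laplacian. *)
Lemma green_laplacian h : neumann_form b k h =
  \sum_(x <- F) (\sum_(y <- F) b x y * (k x - k y)) * h x.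
Proof.
rewrite form_hull; set S := RHS.
have E : \sum_(x <- F) \sum_(y <- F) b x y * (k x - k y) * h y = - S.
  rewrite exchange_big /= /S -sumrN; apply: eq_bigr => x _.
  rewrite mulr_suml -sumrN; apply: eq_bigr => y _.
  by rewrite b_sym; ring.
have -> : \sum_(x <- F) \sum_(y <- F) b x y * (k x - k y) * (h x - h y) =
    S - \sum_(x <- F) \sum_(y <- F) b x y * (k x - k y) * h y.
  rewrite /S -sumrB; apply: eq_bigr => x _.
  rewrite mulr_suml -sumrB; apply: eq_bigr => y _.
  by ring.
by rewrite E; field.
Qed.

(** The differences can also be collected on h, which is arbitrary: this reads
    off the Laplacian of h when k is an indicator. *)
Lemma green_test h : neumann_form b k h =
  \sum_(x <- F) k x * \sum_(y <- F) b x y * (h x - h y).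
Proof.
rewrite form_hull; set S := RHS.
have E : \sum_(x <- F) \sum_(y <- F) b x y * k y * (h x - h y) = - S.
  rewrite exchange_big /= /S -sumrN; apply: eq_bigr => x _.
  rewrite mulr_sumr -sumrN; apply: eq_bigr => y _.
  by rewrite b_sym; ring.
have -> : \sum_(x <- F) \sum_(y <- F) b x y * (k x - k y) * (h x - h y) =
    S - \sum_(x <- F) \sum_(y <- F) b x y * k y * (h x - h y).
  rewrite /S -sumrB; apply: eq_bigr => x _.
  rewrite mulr_sumr -sumrB; apply: eq_bigr => y _.
  by ring.
by rewrite E; field.
Qed.

End Hull.

Lemma Cc_domain f : Cc f -> neumann_domain m b f.
Proof.
move=> cf; split; first exact: (l2_Cc m_gt0 cf).
have [F [uF fF nF]] := Cc_hull cf.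
exact: energy_finite uF fF nF.
Qed.

Lemma Cc_laplacian f : Cc f -> exists2 g, Cc g & neumann_laplacian m b f g.
Proof.
move=> cf; have [F [uF fF nF]] := Cc_hull cf.
pose g x := if x \in F then (\sum_(y <- F) b x y * (f x - f y)) / m x else 0.
have cg : Cc g.
  apply: (@sub_finite_set _ _ [set` F]%classic); last exact: finite_seq.
  by move=> x /=; rewrite /g; case: ifP => //; rewrite eqxx.
exists g => //; split; [exact: Cc_domain|exact: (l2_Cc m_gt0 cg)|].
move=> h _; rewrite (green_laplacian uF fF nF) /l2_dot (real_sum_seq uF).
  apply: eq_big_seq => x xF; rewrite /g xF.
  by field; rewrite gt_eqF.
by move=> x /negPf xF; rewrite /g xF !mul0r.
Qed.

Lemma neumann_formC f g : neumann_form b f g = neumann_form b g f.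
Proof.
rewrite /neumann_form; congr (_ * real_sum _); apply/funext => p; ring.
Qed.

(** The weak equation tested against the indicator of x. *)
Lemma laplacian_pointwise f g x s :
    uniq s -> (forall y, (y \in s) = (0 < b x y)) ->
    neumann_laplacian m b f g ->
  g x * m x = \sum_(y <- s) b x y * (f x - f y).
Proof.
move=> us sP [_ _ weak].
pose h z : R := (z == x)%:R.
have hx z : h z != 0 -> z = x.
  by rewrite /h; have [//|_] := eqVneq z x; rewrite /= eqxx.
have ch : Cc h.
  apply: (@sub_finite_set _ _ [set` [:: x]]%classic); last exact: finite_seq.
  by move=> z /= /hx ->; rewrite mem_head.
have xs : x \notin s by rewrite sP (graph_diag b_graph) ltxx.
have h0 z : z \notin [:: x] -> h z = 0.
  by rewrite inE /h => /negPf ->.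
have h0' z : z \notin x :: s -> h z = 0.
  by rewrite inE negb_or => /andP[zx _]; apply: h0; rewrite inE.
have := weak h (Cc_domain ch).
rewrite neumann_formC (@green_test _ (x :: s)) /=; first last.
- move=> z y /hx -> bxy; rewrite inE; apply/orP; right.
  by rewrite sP lt_neqAle eq_sym bxy b_ge0.
- exact: h0'.
- by rewrite xs.
rewrite big_cons [X in _ + X = _]big_seq [X in _ + X = _]big1 => [|z zs];
  last first.
  by rewrite /h (negPf (_ : z != x)) ?mul0r//; apply: contraNneq xs => <-.
rewrite addr0 big_cons subrr mulr0 add0r {1}/h eqxx mul1r => ->.
rewrite /l2_dot (@real_sum_seq _ _ _ [:: x])//.
  by rewrite big_seq1 /h eqxx mulr1.
by move=> z /h0 ->; rewrite mulr0 mul0r.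
Qed.

(** The left-hand side is the derivative of (f x)^2 along the flow f' = - g.
    Completing the square, - 2 (f x) (f x - f y) <= (f y)^2 / 2; then the edge
    condition trades b x y / m x for C m y, so that what the neighbours
    contribute is a part of the squared l^2 norm, whatever the size of m x. *)
Lemma dissipation_le C f g x s :
    uniq s -> (forall y, (y \in s) = (0 < b x y)) ->
    (forall y, b x y <= C * (m x * m y)) -> neumann_laplacian m b f g ->
  - 2 * f x * g x <= C / 2 * \sum_(y <- s) f y ^+ 2 * m y.
Proof.
move=> us sP bC lfg; rewrite -(ler_pM2r (m_gt0 x)) -(mulrA (- 2 * f x)).
rewrite (laplacian_pointwise us sP lfg) !mulr_sumr mulr_suml.
apply: ler_sum => y _.
have h1 : b x y * f y ^+ 2 <= C * (m x * m y) * f y ^+ 2.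
  by apply: ler_wpM2r => //; exact: sqr_ge0.
have h2 : 0 <= b x y * (2 * f x - f y) ^+ 2 by rewrite mulr_ge0// sqr_ge0.
lra.
Qed.

End Graph.

(** * Growth bounds from forward differences *)

Section ForwardEuler.
Context {R : realType}.

(** The forward differences over steps of length T / n telescope;
    since d is the same for all s, n can be chosen so that T / n < d. *)
Lemma forward_difference_le (F : R -> R) (K T : R) : 0 < T ->
    (forall e, 0 < e -> exists2 d, 0 < d &
       forall s h, 0 <= s -> 0 < h -> h < d ->
       s + h <= T -> F (s + h) - F s <= h * (K + e)) ->
  F T <= F 0 + T * K.
Proof.
move=> T0 FK; rewrite leNgt; apply/negP => lt.
pose e := (F T - F 0 - T * K) / (2 * T).
have e0 : 0 < e by rewrite divr_gt0 ?mulr_gt0//; lra.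
have [d d0 dP] := FK e e0.
pose n := (Num.truncn (T / d)).+1; pose h := T / n%:R.
have n0 : 0 < n%:R :> R by rewrite ltr0n.
have h0 : 0 < h by rewrite divr_gt0.
have hd : h < d.
  by rewrite /h ltr_pdivrMr// mulrC -ltr_pdivrMr//; exact: truncnS_gt.
have hn : n%:R * h = T by rewrite /h mulrC divfK// gt_eqF.
have step i : (i <= n)%N -> F (i%:R * h) <= F 0 + i%:R * h * (K + e).
  elim: i => [|i IH] lein; first by rewrite !mul0r addr0.
  have ih0 : 0 <= i%:R * h by rewrite mulr_ge0// ltW.
  have ihT : i%:R * h + h <= T.
    rewrite -hn -[X in _ + X]mul1r -mulrDl natr1.
    by apply: ler_wpM2r; rewrite ?ler_nat// ltW.
  have := dP _ _ ih0 h0 hd ihT; have := IH (ltnW lein).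
  have -> : i.+1%:R * h = i%:R * h + h by rewrite -natr1 mulrDl mul1r.
  lra.
have := step n (leqnn n); rewrite hn => le.
have : T * e = (F T - F 0 - T * K) / 2 by rewrite /e; field; rewrite gt_eqF.
lra.
Qed.

(** Here - v is the forward derivative of u, uniformly on [0, T], and K bounds
    the derivative - 2 u v of the square of u. *)
Lemma square_growth_le (u v : R -> R) (A B K T : R) : 0 < T ->
    (forall s, 0 <= s -> s <= T ->
       [/\ u s ^+ 2 <= A, v s ^+ 2 <= B & - 2 * u s * v s <= K]) ->
    (forall e, 0 < e -> exists2 d, 0 < d &
       forall s h, 0 <= s -> 0 < h -> h < d ->
       s + h <= T -> ((u s - u (s + h)) / h - v s) ^+ 2 <= e) ->
  u T ^+ 2 <= u 0 ^+ 2 + T * K.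
Proof.
move=> T0 bound diff.
apply: (@forward_difference_le (fun s => u s ^+ 2) K T) => // e e0.
have [A0 B0] : 0 <= A /\ 0 <= B.
  have [uA vB _] := bound 0 (lexx 0) (ltW T0).
  by split; [apply: le_trans uA|apply: le_trans vB]; exact: sqr_ge0.
pose q := e / (4 * (A + 1)).
have q0 : 0 < q by rewrite divr_gt0// mulr_gt0//; lra.
have qA : q * A <= e / 4.
  rewrite /q -[X in _ <= X](_ : e / (4 * (A + 1)) * (A + 1) = _);
    last by field; lra.
  by apply: ler_wpM2l; [exact: ltW|lra].
have qe0 : 0 < q * e / 4 by rewrite divr_gt0// mulr_gt0.
have [d d0 dP] := diff _ qe0.
pose D := 4 * B + q * e + 1.
have D0 : 0 < D by have := mulr_gt0 q0 e0; rewrite /D; lra.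
exists (Num.min d (e / D)); first by rewrite lt_min d0 divr_gt0.
move=> s h s0 h0; rewrite lt_min => /andP[hd hD] shT.
have sT : s <= T by lra.
have [uA vB uv] := bound s s0 sT.
have := dP s h s0 h0 hd shT; set r := _ / h - v s => r2.
have E : u (s + h) = u s - h * (v s + r) by rewrite /r; field; rewrite gt_eqF.
rewrite E.
(* Young's inequality with the weight q *)
have ur : - 2 * u s * r <= e / 2.
  have h1 : 0 <= (q * u s + r) ^+ 2 by exact: sqr_ge0.
  have h2 : q * (- 2 * u s * r) <= q * (e / 2).
    have : q * (q * u s ^+ 2) <= q * (e / 4).
      apply: ler_wpM2l; first exact: ltW.
      by apply: le_trans qA; apply: ler_wpM2l => //; exact: ltW.
    move: r2 h1; lra.
  by rewrite ler_pM2l in h2.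
have vr : h * (v s + r) ^+ 2 <= e / 2.
  have h1 : (v s + r) ^+ 2 <= D / 2.
    have : 0 <= (v s - r) ^+ 2 by exact: sqr_ge0.
    rewrite /D; move: r2 vB; lra.
  have h2 : h * D < e by rewrite -ltr_pdivlMr.
  have : h * (v s + r) ^+ 2 <= h * (D / 2).
    by apply: ler_wpM2l => //; exact: ltW.
  lra.
have -> : (u s - h * (v s + r)) ^+ 2 - u s ^+ 2 =
  h * (- 2 * u s * v s + - 2 * u s * r + h * (v s + r) ^+ 2) by ring.
apply: ler_wpM2l; first exact: ltW.
lra.
Qed.

End ForwardEuler.

(** * Strongly continuous semigroups on l^2(X, m) *)

Section Semigroup.
Context {R : realType} {X : countType} (m : X -> R).
Hypothesis m_gt0 : forall x, 0 < m x.
Variable P : R -> (X -> R) -> (X -> R).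
Hypothesis P_C0 : is_C0_semigroup m P.
Implicit Types (f g : X -> R) (s t T : R).
Local Notation sq := (sqnorm m).

Lemma l2_cvg0P (F : R -> X -> R) :
  (l2_norm m (F t) @[t --> 0^'+] --> (0 : R))%classic <->
  forall e, 0 < e ->
    exists2 d, 0 < d & forall t, 0 < t -> t < d -> sq (F t) < e.
Proof.
split=> [/cvgr0Pnorm_lt cvF e e0|H].
  have [d /= d0 dP] := cvF (Num.sqrt e) (etrans (sqrtr_gt0 e) e0).
  exists d => // t t0 td; have := dP t.
  rewrite /= sub0r normrN gtr0_norm// => /(_ td t0).
  rewrite ger0_norm ?sqrtr_ge0// l2_norm_sqrt ltr_sqrt//.
apply/cvgr0Pnorm_lt => e e0.
have [d d0 dP] := H (e ^+ 2) (exprn_gt0 2 e0).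
exists d => // t /=; rewrite sub0r normrN => td t0; rewrite gtr0_norm// in td.
rewrite ger0_norm ?sqrtr_ge0// l2_norm_sqrt; have := dP t t0 td.
by rewrite -ltr_sqrt ?exprn_gt0// sqrtr_sqr (ger0_norm (ltW e0)).
Qed.

Lemma semigroup_operator t : 0 <= t -> l2_operator m (P t).
Proof.
move=> t0; split=> [f lf|a f g lf lg|].
- exact: (semigroup_l2 P_C0).
- exact: (semigroup_linear P_C0).
have [M MP] := semigroup_bounded P_C0 t0.
exists (M ^+ 2) => f lf; rewrite -!(sqr_l2_norm m_gt0) -exprMn.
rewrite -[leRHS]real_normK ?num_real// ler_sqr ?nnegrE ?sqrtr_ge0//.
exact: le_trans (MP f lf) (ler_norm _).
Qed.

Lemma semigroup_l2_cvg f e : l2 m f -> 0 < e ->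
  exists2 d, 0 < d &
    forall t, 0 < t -> t < d -> sq (fun x => P t f x - f x) < e.
Proof. by move=> lf e0; have /l2_cvg0P/(_ e e0) := semigroup_cvg P_C0 lf. Qed.

(** Otherwise some times t_k tending to 0 carry unbounded norms, while
    P t_k f tends to f for each f: this contradicts uniform boundedness. *)
Lemma semigroup_bounded_near0 : exists M d, [/\ 1 <= M, 0 < d &
  forall t f, 0 < t -> t < d -> l2 m f -> sq (P t f) <= M * sq f].
Proof.
apply: contrapT => H.
have bad (k : nat) : exists tf : R * (X -> R), [/\ 0 < tf.1, tf.1 < k.+1%:R^-1,
    l2 m tf.2 & k.+1%:R * sq tf.2 < sq (P tf.1 tf.2)].
  apply: contrapT => Hk; apply: H; exists k.+1%:R, k.+1%:R^-1; split=> //.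
    by rewrite ler1n.
  move=> t f t0 td lf; rewrite leNgt; apply/negP => lt; apply: Hk.
  by exists (t, f).
have [tf tfP] := choice bad.
pose T k := P (tf k).1.
have T_op k : l2_operator m (T k).
  by have [t0 _ _ _] := tfP k; apply: semigroup_operator; exact: ltW.
have T_pt f : l2 m f -> exists B N, forall n, (N <= n)%N -> sq (T n f) <= B.
  move=> lf; have [d d0 dP] := semigroup_l2_cvg lf (@ltr01 R).
  exists (2 * 1 + 2 * sq f), (Num.truncn d^-1).+1 => n Nn.
  have [t0 td _ _] := tfP n; have [Tl2 _ _] := T_op n.
  apply: le_trans (sqnorm_le_dist m_gt0 (Tl2 _ lf) lf) _.
  rewrite lerD2r ler_pM2l//; apply: ltW; apply: dP => //.
  apply: lt_trans td _; rewrite invf_plt ?posrE//.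
  apply: lt_le_trans (truncnS_gt _) _; rewrite ler_nat; exact: leqW.
have [M [N MP]] := l2_uniform_boundedness m_gt0 T_op T_pt.
pose k := maxn N (Num.truncn M).+1.
have [_ _ lf] := tfP k; apply/negP; rewrite -leNgt.
apply: le_trans (MP k _ _ lf) _; first exact: leq_maxl.
apply: ler_wpM2r; first exact: sqnorm_ge0.
apply: ltW; apply: lt_le_trans (truncnS_gt _) _.
by rewrite ler_nat; apply: leqW; exact: leq_maxr.
Qed.

(** The bound near 0 is iterated with the semigroup law. *)
Lemma semigroup_bounded_on T : exists2 M, 0 <= M &
  forall t f, 0 <= t -> t <= T -> l2 m f -> sq (P t f) <= M * sq f.
Proof.
have [M [d [M1 d0 MP]]] := semigroup_bounded_near0.
have M0 : 0 <= M by lra.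
pose h := d / 2.
have [h0 hd] : 0 < h /\ h < d by rewrite /h; lra.
have step k t f : 0 <= t -> t <= k%:R * h -> l2 m f ->
    sq (P t f) <= M ^+ k * sq f.
  elim: k t f => [|k IH] t f t0 tk lf.
    have -> : t = 0 by rewrite mul0r in tk; lra.
    by rewrite (semigroup0 P_C0)// expr0 mul1r.
  have Mk : sq f * M ^+ k <= M * (sq f * M ^+ k).
    by rewrite ler_peMl// mulr_ge0 ?sqnorm_ge0// exprn_ge0.
  have [le|lt] := leP t (k%:R * h).
    apply: le_trans (IH t f t0 le lf) _.
    by rewrite exprS -mulrA (mulrC _ (sq f)).
  rewrite -natr1 mulrDl mul1r in tk.
  have kh : 0 <= k%:R * h by rewrite mulr_ge0// ltW.
  have -> : t = (t - k%:R * h) + k%:R * h by rewrite subrK.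
  rewrite (semigroupD P_C0)//; last by lra.
  have lP : l2 m (P (k%:R * h) f) by apply: (semigroup_l2 P_C0).
  have th : t - k%:R * h < d by lra.
  apply: le_trans (MP _ _ _ th lP) _; first by lra.
  by rewrite exprS -mulrA; apply: ler_wpM2l => //; exact: IH.
exists (M ^+ (Num.truncn (T / h)).+1); first exact: exprn_ge0.
move=> t f t0 tT lf; apply: step => //; apply: le_trans tT _.
by rewrite -ler_pdivrMr//; apply: ltW; exact: truncnS_gt.
Qed.

(** The orbit of f over [0, T] is compact in l^2.  Concretely, steps of a fixed
    length h cover the interval, and within one step the orbit stays close to
    its value at the start of the step, whose tail is small off a finite set. *)
Lemma semigroup_uniform_tail T f (e : R) : l2 m f -> 0 < e ->
  exists K : seq X, forall (s : R) (t : seq X), 0 <= s -> s <= T -> uniq t ->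
    (forall x, x \in t -> x \notin K) ->
    \sum_(x <- t) P s f x ^+ 2 * m x <= e.
Proof.
move=> lf e0; have [M M0 MP] := semigroup_bounded_on T.
have e1 : 0 < e / (4 * (M + 1)) by rewrite divr_gt0// mulr_gt0//; lra.
have [d d0 dP] := semigroup_l2_cvg lf e1.
pose h := d / 2.
have [h0 hd] : 0 < h /\ h < d by rewrite /h; lra.
have step k : exists K : seq X, forall (s : R) (t : seq X),
    0 <= s -> s <= T -> s <= k%:R * h -> uniq t ->
    (forall x, x \in t -> x \notin K) -> \sum_(x <- t) P s f x ^+ 2 * m x <= e.
  elim: k => [|k [K IH]].
    have [K KP] := l2_tail m_gt0 lf e0.
    exists K => s t s0 _ sk ut tK; have -> : s = 0 by rewrite mul0r in sk; lra.
    by rewrite (semigroup0 P_C0)//; exact: KP.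
  have kh : 0 <= k%:R * h by rewrite mulr_ge0// ltW.
  have lk : l2 m (P (k%:R * h) f) by apply: (semigroup_l2 P_C0).
  have e4 : 0 < e / 4 by lra.
  have [K' KP'] := l2_tail m_gt0 lk e4.
  exists (K ++ K') => s t s0 sT sk ut tK.
  have tK1 x : x \in t -> x \notin K.
    by move=> /tK; rewrite mem_cat negb_or => /andP[].
  have tK2 x : x \in t -> x \notin K'.
    by move=> /tK; rewrite mem_cat negb_or => /andP[].
  have [le|lt] := leP s (k%:R * h); first exact: IH.
  rewrite -natr1 mulrDl mul1r in sk.
  pose w := s - k%:R * h.
  have [w0 wd] : 0 < w /\ w < d by rewrite /w; lra.
  have lw : l2 m (P w f) by apply: (semigroup_l2 P_C0) => //; exact: ltW.
  have ls : l2 m (P s f) by apply: (semigroup_l2 P_C0).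
  have Es : P s f = P (k%:R * h) (P w f).
    by rewrite -(semigroupD P_C0)// ?(ltW w0)// /w addrC subrK.
  have near : sq (fun x => P s f x - P (k%:R * h) f x) <= e / 4.
    rewrite Es -(l2_operatorB (semigroup_operator kh))//.
    apply: le_trans (MP _ _ kh _ (l2B m_gt0 lw lf)) _; first by lra.
    apply: le_trans (ler_wpM2l M0 (ltW (dP w w0 wd))) _.
    have -> : e / 4 = (M + 1) * (e / (4 * (M + 1))) by field; lra.
    by apply: ler_wpM2r; [exact: ltW|lra].
  have t1 := sum_le_sqnorm m_gt0 (l2B m_gt0 ls lk) ut.
  have t2 := KP' t ut tK2.
  have : \sum_(x <- t) P s f x ^+ 2 * m x <=
      2 * (\sum_(x <- t) (P s f x - P (k%:R * h) f x) ^+ 2 * m x) +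
      2 * (\sum_(x <- t) P (k%:R * h) f x ^+ 2 * m x).
    rewrite !mulr_sumr -big_split /=; apply: ler_sum => x _.
    rewrite (mulrA 2) (mulrA 2) -mulrDl; apply: ler_wpM2r; first exact: ltW.
    by have := sqr_ge0 (P s f x - 2 * P (k%:R * h) f x); lra.
  lra.
have [K KP] := step (Num.truncn (T / h)).+1.
exists K => s t s0 sT; apply: KP => //; apply: le_trans sT _.
by rewrite -ler_pdivrMr//; apply: ltW; exact: truncnS_gt.
Qed.

End Semigroup.

(** * The generator along an orbit *)

Section Generator.
Context {R : realType} {X : countType} (m : X -> R).
Hypothesis m_gt0 : forall x, 0 < m x.
Variables (P : R -> (X -> R) -> (X -> R)) (L : (X -> R) -> (X -> R) -> Prop).
Hypothesis P_exp : is_exp_semigroup m L P.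
Local Notation sq := (sqnorm m).

Let P_C0 : is_C0_semigroup m P := P_exp.1.
Let P_op (s : R) (s0 : 0 <= s) := semigroup_operator m_gt0 P_C0 s0.

Definition generator_error f g (h : R) x : R := (f x - P h f x) / h - g x.

Lemma l2_generator_error f g h : 0 < h -> l2 m f -> l2 m g ->
  l2 m (generator_error f g h).
Proof.
move=> /ltW h0 lf lg; apply: (l2B m_gt0) => //.
have := l2Z m_gt0 h^-1 (l2B m_gt0 lf (semigroup_l2 P_C0 h0 lf)).
by under eq_fun do rewrite mulrC.
Qed.

(** The error at time s is the image under P s of the error at time 0: hence the
    difference quotients converge uniformly in s on bounded intervals. *)
Lemma semigroup_generator_error f g s h : 0 <= s -> 0 < h -> l2 m f -> l2 m g ->
  P s (generator_error f g h) =
  (fun x => (P s f x - P (s + h) f x) / h - P s g x).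
Proof.
move=> s0 h0 lf lg; have lP := semigroup_l2 P_C0 (ltW h0) lf.
have ld := l2B m_gt0 lf lP.
have -> : generator_error f g h = (fun x => h^-1 * (f x - P h f x) - g x).
  by apply/funext => x; rewrite /generator_error mulrC.
rewrite (l2_operatorB (P_op s0) (l2Z m_gt0 h^-1 ld) lg).
rewrite (l2_operatorZ m_gt0 (P_op s0) h^-1 ld) (l2_operatorB (P_op s0) lf lP).
rewrite (semigroupD P_C0)// ?ltW//.
by apply/funext => x; rewrite mulrC.
Qed.

Lemma generator_error_cvg f g (e : R) : l2 m f -> l2 m g -> L f g -> 0 < e ->
  exists2 d, 0 < d & forall h, 0 < h -> h < d -> sq (generator_error f g h) < e.
Proof.
move=> lf lg Lfg e0.
by have /l2_cvg0P/(_ e e0) := (P_exp.2 f g lf lg).1 Lfg.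
Qed.

Lemma generator_commutes f g s : 0 <= s -> l2 m f -> l2 m g ->
  L f g -> L (P s f) (P s g).
Proof.
move=> s0 lf lg Lfg; have [Pl2 _ _] := P_op s0.
apply: (P_exp.2 _ _ (Pl2 _ lf) (Pl2 _ lg)).2.
apply/l2_cvg0P => e e0; have [M M0 MP] := semigroup_bounded_on m_gt0 P_C0 s.
have e1 : 0 < e / (M + 1) by rewrite divr_gt0//; lra.
have [d d0 dP] := generator_error_cvg lf lg Lfg e1.
exists d => // h h0 hd.
have -> : (fun x => (P s f x - P h (P s f) x) / h - P s g x) =
          P s (generator_error f g h).
  by rewrite semigroup_generator_error// addrC (semigroupD P_C0)// ltW.
apply: le_lt_trans (MP _ _ s0 (lexx s) (l2_generator_error h0 lf lg)) _.
apply: le_lt_trans (_ : M * (e / (M + 1)) < _).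
  by apply: ler_wpM2l => //; apply: ltW; exact: dP.
rewrite -[ltRHS](_ : (M + 1) * (e / (M + 1)) = _); last by field; lra.
by rewrite ltr_pM2r//; lra.
Qed.

End Generator.

(** * Vanishing at infinity *)

Theorem theorem7p3 (R : realType) (X : countType) (m : X -> R)
    (b : X -> X -> R)
    (m_gt0 : forall x, 0 < m x)
    (b_graph : is_graph b)
    (b_connected : connected_graph b)
    (b_locally_finite : locally_finite_graph b)
    (b_edge : edge_condition m b)
    (P : R -> (X -> R) -> (X -> R))
    (P_neumann : is_neumann_semigroup m b P) :
  feller P.
Proof.
move=> T T0 f cf e e0.
have P_C0 := P_neumann.1.
have [C C0 bC] := b_edge.
have [N NP] := neighbours_exist b_locally_finite.
have [g cg Lfg] := Cc_laplacian m_gt0 b_graph b_locally_finite cf.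
have lf := l2_Cc m_gt0 cf; have lg := l2_Cc m_gt0 cg.
have [M M0 MP] := semigroup_bounded_on m_gt0 P_C0 T.
(* q solves T * (C / 2 * q) = e ^+ 2. *)
pose q := 2 * e ^+ 2 / (T * C).
have q0 : 0 < q by rewrite divr_gt0 ?mulr_gt0 ?exprn_gt0.
have [K KP] := semigroup_uniform_tail m_gt0 P_C0 T lf q0.
have decay x : f x = 0 -> (forall y, y \in N x -> y \notin K) ->
    `|P T f x| <= e.
  move=> fx NK; have [uN NE] := NP x.
  suff : P T f x ^+ 2 <= P 0 f x ^+ 2 + T * (C / 2 * q).
    rewrite (semigroup0 P_C0)// fx expr0n add0r.
    have -> : T * (C / 2 * q) = e ^+ 2 by rewrite /q; field; rewrite !gt_eqF.
    by rewrite -[X in X <= _]real_normK ?num_real// ler_sqr ?nnegrE// ltW.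
  apply: (@square_growth_le _ (fun s => P s f x) (fun s => P s g x)
    (M * sqnorm m f / m x) (M * sqnorm m g / m x)) => //.
    move=> s s0 sT; split.
    - rewrite ler_pdivlMr//; apply: le_trans (MP s f s0 sT lf).
      by apply: term_le_sqnorm => //; apply: (semigroup_l2 P_C0).
    - rewrite ler_pdivlMr//; apply: le_trans (MP s g s0 sT lg).
      by apply: term_le_sqnorm => //; apply: (semigroup_l2 P_C0).
    have Ls := generator_commutes m_gt0 P_neumann s0 lf lg Lfg.
    have := dissipation_le m_gt0 b_graph b_locally_finite uN NE (bC x) Ls.
    move/le_trans; apply.
    by apply: ler_wpM2l; [rewrite divr_ge0// ltW|exact: KP].
  move=> r r0.
  have r1 : 0 < r * m x / (M + 1) by rewrite divr_gt0 ?mulr_gt0//; lra.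
  have [d d0 dP] := generator_error_cvg P_neumann lf lg Lfg r1.
  exists d => // s h s0 h0 hd shT.
  have sT : s <= T by lra.
  have lE := l2_generator_error m_gt0 P_neumann h0 lf lg.
  have := term_le_sqnorm m_gt0 x (semigroup_l2 P_C0 s0 lE).
  rewrite (semigroup_generator_error m_gt0 P_neumann)// => le1.
  rewrite -(ler_pM2r (m_gt0 x)); apply: le_trans le1 _.
  rewrite -(semigroup_generator_error m_gt0 P_neumann)//.
  apply: le_trans (MP s _ s0 sT lE) _.
  apply: le_trans (ler_wpM2l M0 (ltW (dP h h0 hd))) _.
  rewrite -[leRHS](_ : (M + 1) * (r * m x / (M + 1)) = _); last by field; lra.
  by apply: ler_wpM2r; [exact: ltW|lra].
have /finite_seqP[s sE] := cf.
pose F := s ++ flatten (map N K).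
exists (fun x => if x \in F then P T f x else 0).
  apply: (@sub_finite_set _ _ [set` F]%classic); last exact: finite_seq.
  by move=> x /=; case: ifP => //; rewrite eqxx.
move=> x; case: ifPn => [_|]; first by rewrite subrr normr0 ltW.
rewrite mem_cat negb_or subr0 => /andP[xs xK]; apply: decay.
  apply/eqP; apply: contraNT xs => fx.
  by have : [set x | f x != 0]%classic x by []; rewrite sE.
move=> y; rewrite (NP x).2 => bxy; apply: contraNN xK => yK.
apply/flatten_mapP; exists y => //.
by rewrite (NP y).2 (graph_sym b_graph).
Qed.
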